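(* Let $\mathbb B=(A,\prec_1,\prec_2)$ be a bi-subordination algebra with $A$ a bounded distributive lattice. For $a\in A$ let $\Delta_{\prec_1}a$ be the ideal $\{b\in A\mid b\prec_1a\}$ and $\nabla_{\prec_2}a$ the filter $\{b\in A\mid a\prec_2b\}$. Then: (1) $\mathbb B$ satisfies (P1) if and only if $\Delta_{\prec_1}(a\vee b)\subseteq\nabla_{\prec_2}a\odot\Delta_{\prec_1}b$ for all $a,b\in A$; (2) $\mathbb B$ satisfies (P2) if and only if $\nabla_{\prec_2}(a\wedge b)\subseteq\Delta_{\prec_1}a\oplus\nabla_{\prec_2}b$ for all $a,b\in A$.
   Context: A bi-subordination algebra is $(A,\prec_1,\prec_2)$ such that each $\prec\,\in\{\prec_1,\prec_2\}$ is a subordination relation: $\bot\prec\bot$; $\top\prec\top$; $a\le b\prec x\Rightarrow a\prec x$; $b\prec x\le y\Rightarrow b\prec y$; $a\prec x\ \&\ a\prec y\Rightarrow a\prec x\wedge y$; $a\prec x\ \&\ b\prec x\Rightarrow a\vee b\prec x$. For a filter $F$ and an ideal $I$ of $A$: $F\odot I:=\bigcap\{\mathrm{Id}(I\cup\{a\})\mid a\in F\}$ and $I\oplus F:=\bigcap\{\mathrm{Fil}(F\cup\{a\})\mid a\in I\}$, where $\mathrm{Id}(X)$ and $\mathrm{Fil}(X)$ denote the ideal and the filter of $A$ generated by $X$. (P1) For all $a,b,c\in A$: $c\prec_1a\vee b\Rightarrow\forall d[a\prec_2d\Rightarrow\exists e(e\prec_1b\ \&\ c\le e\vee d)]$. (P2)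 For all $a,b,c\in A$: $a\wedge b\prec_2c\Rightarrow\forall d[d\prec_1a\Rightarrow\exists e(b\prec_2e\ \&\ d\wedge e\le c)]$. *)

(* Defs.v *)
From HB Require Import structures.
From mathcomp Require Import all_boot all_order.
From mathcomp Require Import boolp classical_sets.
Set Implicit Arguments.
Unset Strict Implicit.
Unset Printing Implicit Defensive.
Import Order.Theory.
Local Open Scope order_scope.

Section BiSubordination.
Context {d : Order.disp_t} {A : tbDistrLatticeType d}.
Implicit Types (a b c x y e : A) (I F X : set A) (prec : A -> A -> Prop).

Record subordination prec : Prop := Subordination {
  sub_bot : prec \bot \bot;
  sub_top : prec \top \top;
  sub_lel : forall a b x, a <= b -> prec b x -> prec a x;
  sub_ler : forall b x y, prec b x -> x <= y -> prec b y;
  sub_meet : forall a x y, prec a x -> prec a y -> prec a (x `&` y);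
  sub_join : forall a b x, prec a x -> prec b x -> prec (a `|` b) x
}.

Definition bisubordination (prec1 prec2 : A -> A -> Prop) : Prop :=
  subordination prec1 /\ subordination prec2.

(* Ideals and filters are nonempty but need not be proper. *)
Record is_ideal I : Prop := IsIdeal {
  ideal_nonempty : (I !=set0)%classic;
  ideal_down : forall a b, a <= b -> I b -> I a;
  ideal_join : forall a b, I a -> I b -> I (a `|` b)
}.

Record is_filter F : Prop := IsFilter {
  filter_nonempty : (F !=set0)%classic;
  filter_up : forall a b, a <= b -> F a -> F b;
  filter_meet : forall a b, F a -> F b -> F (a `&` b)
}.

Definition Id X : set A := smallest is_ideal X.
Definition Fil X : set A := smallest is_filter X.

(* The operations below are meant for a filter F and an ideal I, but they make
   sense for arbitrary subsets of A. *)
Definition odot F I : set A := (\bigcap_(a in F) Id (I `|` [set a]))%classic.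
Definition oplus I F : set A := (\bigcap_(a in I) Fil (F `|` [set a]))%classic.

Definition Delta prec (a : A) : set A := [set b | prec b a]%classic.
Definition Nabla prec (a : A) : set A := [set b | prec a b]%classic.

Lemma Delta_ideal prec a : subordination prec -> is_ideal (Delta prec a).
Proof.
move=> S; split.
- by exists \bot; exact: (sub_ler S (sub_bot S) (le0x a)).
- by move=> b c le_bc Hc; exact: (sub_lel S le_bc Hc).
- by move=> b c; exact: (sub_join S).
Qed.

Lemma Nabla_filter prec a : subordination prec -> is_filter (Nabla prec a).
Proof.
move=> S; split.
- by exists \top; exact: (sub_lel S (lex1 a) (sub_top S)).
- by move=> b c le_bc Hb; exact: (sub_ler S Hb le_bc).
- by move=> b c; exact: (sub_meet S).
Qed.

Definition P1 (prec1 prec2 : A -> A -> Prop) : Prop :=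
  forall a b c, prec1 c (a `|` b) ->
  forall x, prec2 a x -> exists e, prec1 e b /\ c <= e `|` x.

Definition P2 (prec1 prec2 : A -> A -> Prop) : Prop :=
  forall a b c, prec2 (a `&` b) c ->
  forall x, prec1 x a -> exists e, prec2 b e /\ x `&` e <= c.

End BiSubordination.

(* Main.v *)
Require Import Defs.
From HB Require Import structures.
From mathcomp Require Import all_boot all_order.
From mathcomp Require Import boolp classical_sets.

Import Order.Theory.

(** Membership of [c] in [odot (Nabla prec2 a) (Delta prec1 b)] means that, for every [x] with
    [prec2 a x], [c] lies in the ideal generated by [Delta prec1 b] and [x]. By [Id_setU1] this says
    that [c] is below [e] joined with [x] for some [e] with [prec1 e b], which is the conclusion of
    [P1]; so the inclusion is [P1] itself, rephrased. [P2] is handled in the same way through the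
    dual [Fil_setU1]. *)

Lemma Id_setU1 (d : Order.disp_t) (A : tbDistrLatticeType d) (I : set A) (a c : A) :
  is_ideal I ->
  Id (I `|` [set a])%classic c <-> exists e, I e /\ (c <= e `|` a)%O.
Proof.
move=> idI; split=> [|[e [Ie le_c]] J [idJ sub]].
  (* The generated ideal is the least one, so it suffices that the described set is an ideal
     containing [I] and [a]; nonemptiness of [I] supplies the [e] needed for [a] itself. *)
  move/(_ [set x | exists e, I e /\ (x <= e `|` a)%O]%classic); apply; split; last first.
    have [e0 Ie0] := ideal_nonempty idI.
    move=> x [Ix|->]; first by exists x; rewrite leUl.
    by exists e0; rewrite leUr.
  split.
  - by have [e0 Ie0] := ideal_nonempty idI; exists e0, e0; rewrite leUl.
  - by move=> x y le_xy [e [Ie le_y]]; exists e; rewrite (le_trans le_xy).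
  - move=> x y [e [Ie le_x]] [f [If le_y]].
    exists (e `|` f)%O; split; first exact: (ideal_join idI).
    (* Duplicating [a] regroups the bound as the join of the bounds for [x] and [y]. *)
    by rewrite -[a in leRHS]joinxx joinACA leU2.
apply: (ideal_down idJ le_c); apply: (ideal_join idJ); apply: sub.
  by left.
by right.
Qed.

(** Order dual of [Id_setU1]. *)
Lemma Fil_setU1 (d : Order.disp_t) (A : tbDistrLatticeType d) (F : set A) (a c : A) :
  is_filter F ->
  Fil (F `|` [set a])%classic c <-> exists e, F e /\ (a `&` e <= c)%O.
Proof.
move=> fiF; split=> [|[e [Fe le_c]] J [fiJ sub]].
  move/(_ [set x | exists e, F e /\ (a `&` e <= x)%O]%classic); apply; split; last first.
    have [e0 Fe0] := filter_nonempty fiF.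
    move=> x [Fx|->]; first by exists x; rewrite leIr.
    by exists e0; rewrite leIl.
  split.
  - by have [e0 Fe0] := filter_nonempty fiF; exists e0, e0; rewrite leIr.
  - by move=> x y le_xy [e [Fe le_x]]; exists e; rewrite (le_trans le_x).
  - move=> x y [e [Fe le_x]] [f [Ff le_y]].
    exists (e `&` f)%O; split; first exact: (filter_meet fiF).
    by rewrite -[a in leLHS]meetxx meetACA leI2.
apply: (filter_up fiJ le_c); apply: (filter_meet fiJ); apply: sub.
  by right.
by left.
Qed.

Theorem mainTheorem10 (d : Order.disp_t) (A : tbDistrLatticeType d)
    (prec1 prec2 : A -> A -> Prop)
    (Hprec : bisubordination prec1 prec2) :
  (P1 prec1 prec2 <->
    (forall a b : A,
      (Delta prec1 (a `|` b)%O `<=` odot (Nabla prec2 a) (Delta prec1 b))%classic))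
  /\
  (P2 prec1 prec2 <->
    (forall a b : A,
      (Nabla prec2 (a `&` b)%O `<=` oplus (Delta prec1 a) (Nabla prec2 b))%classic)).
Proof.
have [sub1 sub2] := Hprec.
split; split=> H a b c.
- by move=> Hc x Hx; apply/(Id_setU1 _ _ _ _ _ (Delta_ideal b sub1)); exact: H Hx.
(* The inclusion [H] unfolds by conversion to membership of [c] in the ideal generated by
   [Delta prec1 b] and [x]. *)
- by move=> Hc x Hx; apply/(Id_setU1 _ _ _ x c (Delta_ideal b sub1)); exact: H Hx.
- by move=> Hc x Hx; apply/(Fil_setU1 _ _ _ _ _ (Nabla_filter b sub2)); exact: H Hx.
- by move=> Hc x Hx; apply/(Fil_setU1 _ _ _ x c (Nabla_filter b sub2)); exact: H Hx.
Qed.
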